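(* Let $G$ be a finite abelian group, let $H$ be a subgroup of $G$, let $\widehat{G}_{H} := \{ \chi \in \widehat{G} \mid \chi(h) = 1 \text{ for all } h \in H \}$, and let $T \subset G$ and $X \subset \widehat{G}$ be such that $G = \bigsqcup_{t \in T} tH$ and $\widehat{G} = \bigsqcup_{\chi \in X} \chi \widehat{G}_{H}$. For $\chi \in X$, $t\in T$ and $h \in H$ put $$ y_{tH}^{\chi} := \sum_{h' \in H} \chi(th')\, x_{th'}, \qquad z_{h} := \frac{1}{|H|} \sum_{\chi \in X} \chi(h^{-1})\, \Theta_{G/H}\left( y_{tH}^{\chi} \right), \qquad y_{tH} := \sum_{h' \in H} x_{th'}. $$ Then for every $h \in H$, $$ z_{h} = \Theta_{G/H}\left( y_{tH} \right)_{h} \in \mathbb{Z}[x_{g}]. $$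
   Context: For a finite group $G$, let $x_g$ ($g \in G$) be independent commuting indeterminates. The group determinant of $G$ is $\Theta_G(x_g) := \det\left( x_{gh^{-1}} \right)_{g,h \in G} \in \mathbb{Z}[x_g]$, where $\mathbb{Z}[x_g]$ is the polynomial ring over $\mathbb{Z}$ in all the variables $x_g$, $g\in G$; it does not depend on the ordering of the elements of $G$. If $K$ is a finite group and $(w_k)_{k \in K}$ is a family of elements of a commutative ring, $\Theta_K(w_k)$ denotes the determinant of $(w_{kl^{-1}})_{k,l \in K}$. Thus $\Theta_{G/H}(y_{tH}^{\chi})$ (for fixed $\chi$) and $\Theta_{G/H}(y_{tH})$ are the group determinant of $G/H$ with the variable indexed by the coset $tH$ replaced by $y_{tH}^{\chi}$, respectively $y_{tH}$. For a finite abelian group $G$, $\widehat{G}$ denotes the group of characters (homomorphisms) $G \to \mathbb{C}^{\times}$. For $f(x_g) \in \mathbb{Z}[x_g]$ and $h \in G$ ($G$ abelian), $f(x_g)_h$ denotes the sum of all monomial terms $c\, x_{g_1} x_{g_2} \cdots x_{g_k}$ of $f(x_g)$ satisfying $g_1 g_2 \cdots g_k = h$ in $G$. *)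

(* Defs.v *)
From HB Require Import structures.
From mathcomp Require Import all_boot all_order all_algebra all_fingroup.
From mathcomp Require Import finmap complex reals mpoly.

Set Implicit Arguments.
Unset Strict Implicit.
Unset Printing Implicit Defensive.

Import GRing.Theory.
Local Open Scope ring_scope.

Definition group_det (R : comNzRingType) (kT : finGroupType) (K : {group kT})
    (w : kT -> R) : R :=
  \det (\matrix_(i < #|K|, j < #|K|) w (enum_val i * (enum_val j)^-1)%g).

Section FiniteGroup.

Variable gT : finGroupType.

(* The variables x_g of a polynomial ring are numbered by the library's       *)
(* enumeration of gT: x_g is 'X_(enum_rank g).                                *)
Definition gvar (R : comNzRingType) (g : gT) : {mpoly R[#|gT|]} :=
  'X_(enum_rank g).

(* The product g_1 ... g_k attached to the monomial x_{g_1} ... x_{g_k}; the  *)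
(* order of the factors is irrelevant only when gT is abelian.                *)
Definition mnm_prod (m : 'X_{1..#|gT|}) : gT :=
  (\prod_(i < #|gT|) enum_val i ^+ m i)%g.

Definition mpart (R : comNzRingType) (f : {mpoly R[#|gT|]}) (h : gT) :
    {mpoly R[#|gT|]} :=
  \sum_(m <- msupp f | mnm_prod m == h) f@_m *: 'X_[m].

(* The group determinant of gT / H at a family (y_{tH}) given through the     *)
(* representatives t \in T: the coset c receives y t for the t \in T lying    *)
(* in c. Elements of coset_of H are right cosets, which are the tH when gT is *)
(* abelian.                                                                   *)
Definition quotient_det (R : comNzRingType) (H : {group gT}) (T : {set gT})
    (y : gT -> R) : R :=
  group_det ([set: gT] / H)%G
    (fun c : coset_of H => y (transversal_repr 1%g T (c : {set gT}))).

Definition left_transversal (H : {group gT}) (T : {set gT}) : Prop :=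
  \bigcup_(t in T) (t *: H)%g = [set: gT] /\
  {in T &, forall s t, s != t -> [disjoint (s *: H)%g & (t *: H)%g]}.

Section Characters.

Variable C : fieldType.

Definition dual : {pred {ffun gT -> C}} :=
  [pred chi : {ffun gT -> C} | [forall g, chi g != 0] &&
    [forall g, forall h, chi (g * h)%g == chi g * chi h]].

Definition dual_ann (H : {group gT}) : {pred {ffun gT -> C}} :=
  [pred chi : {ffun gT -> C} | (chi \in dual) && [forall h in H, chi h == 1]].

Definition in_dual_coset (H : {group gT}) (chi psi : {ffun gT -> C}) : Prop :=
  exists2 eta : {ffun gT -> C}, eta \in dual_ann H &
    psi = [ffun g => chi g * eta g].

Definition dual_transversal (H : {group gT}) (X : {fset {ffun gT -> C}}) :
    Prop :=
  [/\ {subset X <= dual},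
      forall psi, psi \in dual <->
        exists2 chi, chi \in X & in_dual_coset H chi psi &
      {in X &, forall chi1 chi2, chi1 != chi2 ->
        forall psi, ~ (in_dual_coset H chi1 psi /\ in_dual_coset H chi2 psi)}].

End Characters.

End FiniteGroup.

Arguments gvar {gT} R g.

(* Main.v *)
Require Import Defs.
From HB Require Import structures.
From mathcomp Require Import all_boot all_order all_algebra all_fingroup.
From mathcomp Require Import finmap complex reals mpoly.
From mathcomp Require Import cyclic cyclotomic algC separable commutator.
From mathcomp Require Import classfun character.

Set Implicit Arguments.
Unset Strict Implicit.
Unset Printing Implicit Defensive.

Import GRing.Theory Num.Theory.
Local Open Scope ring_scope.

(** Let Theta be the group determinant of G / H at the family y_{tH}, taken
    over the complex numbers.  A character chi of G acts on polynomials by the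
    substitution x_g |-> chi(g) x_g, which multiplies a monomial of product k
    by chi(k) ([mcoeff_twist]).  This substitution turns y_{tH} into
    y_{tH}^chi, and it is a ring morphism, so it turns Theta into the
    determinant occurring in z_h.  The coefficient of z_h at a monomial of
    product k is therefore the coefficient of Theta there, times
      1/|H| * sum over chi in X of chi(h^-1 k),
    and everything reduces to showing that this factor is 1 if k = h and 0
    otherwise, for each monomial that occurs in Theta.

    Two facts give this.  The first is that a character eta trivial on H takes
    the value 1 on the product of every monomial of Theta.  Indeed twisting by
    eta multiplies y_{tH} by eta(t), which only depends on the coset tH; this
    conjugates the matrix (y_{c d^-1}) by a diagonal matrix and so fixes Theta
    ([quotient_det_twist]).

    The second is the orthogonality relation [sum_dual_transversal]: if every
    character trivial on H is 1 at k, then the sum of chi(k) over chi in X is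
    |H| if k = 1, and 0 otherwise.  For k <> 1 pick a character psi with
    psi(k) <> 1; multiplication by psi permutes the cosets represented by X,
    and chi(k) only depends on the coset of chi, so the sum equals psi(k) times
    itself.  For k = 1, the vanishing just proved allows one to sum over all of
    H instead; after exchanging the two sums, each character of X nontrivial on
    H contributes 0 and the unique one trivial on H contributes |H|.

    The separating character psi is found among the linear characters with
    algebraic values ([dual_separates]): its values are powers of a primitive
    root of unity, which can be read in any algebraically closed field of
    characteristic 0. *)

Arguments dual {gT C} _.

(** * Characters with values in a field *)

Lemma closed_prim_root_exists (C : numClosedFieldType) (n : nat) :
  (0 < n)%N -> exists w : C, n.-primitive_root w.
Proof.
move=> n_gt0; have [r Dp] := closed_field_poly_normal ('X^n - 1 : {poly C}).
rewrite (monicP _) ?monicXnsubC // scale1r in Dp.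
have rn1: all n.-unity_root r by apply/allP=> z; rewrite -root_prod_XsubC -Dp.
have sz_r: (n < (size r).+1)%N.
  by rewrite -(size_prod_XsubC r id) -Dp size_XnsubC.
have [|z] := hasP (has_prim_root n_gt0 rn1 _ sz_r); last by exists z.
by rewrite -separable_prod_XsubC -Dp separable_Xn_sub_1 // pnatr_eq0 -lt0n.
Qed.

Lemma dual_neq0 (gT : finGroupType) (C : fieldType) (chi : {ffun gT -> C}) g :
  chi \in dual -> chi g != 0.
Proof. by case/andP=> /forallP. Qed.

Lemma dualM (gT : finGroupType) (C : fieldType) (chi : {ffun gT -> C}) :
  chi \in dual -> {morph chi : g h / (g * h)%g >-> g * h}.
Proof. by case/andP=> _ /forallP chiM g h; apply/eqP/(forallP (chiM g)). Qed.

Lemma dual1 (gT : finGroupType) (C : fieldType) (chi : {ffun gT -> C}) :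
  chi \in dual -> chi 1%g = 1.
Proof.
move=> Dchi; apply: (mulfI (dual_neq0 1%g Dchi)).
by rewrite -dualM // mulg1 mulr1.
Qed.

Lemma dualX (gT : finGroupType) (C : fieldType) (chi : {ffun gT -> C}) g n :
  chi \in dual -> chi (g ^+ n)%g = chi g ^+ n.
Proof.
move=> Dchi; elim: n => [|n IHn]; first by rewrite expg0 expr0 dual1.
by rewrite expgS exprS dualM // IHn.
Qed.

(** A function that is multiplicative and maps 1 to 1 cannot vanish, since
    chi(g) chi(g^-1) = 1. *)
Lemma dualP (gT : finGroupType) (C : fieldType) (chi : {ffun gT -> C}) :
    chi 1%g = 1 -> {morph chi : g h / (g * h)%g >-> g * h} -> chi \in dual.
Proof.
move=> chi1 chiM; apply/andP; split; apply/forallP=> g; last first.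
  by apply/forallP=> h; apply/eqP/chiM.
apply/eqP=> chi_g0; have /eqP := chi1.
by rewrite -(mulgV g) chiM chi_g0 mul0r eq_sym oner_eq0.
Qed.

Lemma mul_dual (gT : finGroupType) (C : fieldType) (chi psi : {ffun gT -> C}) :
  chi \in dual -> psi \in dual -> [ffun g => chi g * psi g] \in dual.
Proof.
move=> Dchi Dpsi; apply: dualP => [|g h]; first by rewrite ffunE !dual1 ?mulr1.
by rewrite !ffunE !dualM // mulrACA.
Qed.

Lemma inv_dual (gT : finGroupType) (C : fieldType) (chi : {ffun gT -> C}) :
  chi \in dual -> [ffun g => (chi g)^-1] \in dual.
Proof.
move=> Dchi; apply: dualP => [|g h]; first by rewrite ffunE dual1 ?invr1.
by rewrite !ffunE dualM // invfM.
Qed.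

(** A linear character with algebraic values separates k from 1; only the
    exponents of its values, as powers of a primitive root of unity, matter for
    it to be a character, and these make sense over C. *)
Lemma dual_separates (C : numClosedFieldType) (gT : finGroupType) (k : gT) :
    abelian [set: gT] -> k != 1%g ->
  exists2 psi : {ffun gT -> C}, psi \in dual & psi k != 1.
Proof.
move=> abelG ntk; set G := [set: gT]%G.
(* The linear characters jointly have the derived subgroup as kernel. *)
have [i lin_i neq1]:
    exists2 i : Iirr G, 'chi_i \is a linear_char & 'chi_i k != 1.
  pose sep := [pred i : Iirr G | ('chi_i \is a linear_char) && ('chi_i k != 1)].
  have [i /andP[lin_i neq1] | no_i] := pickP sep; first by exists i.
  have : k \notin G^`(1)%g by rewrite (derG1P abelG) inE.
  rewrite -cap_cfker_lin_irr.
  case/bigcapP=> i lin_i; have := no_i i; rewrite /= lin_i => /negbFE.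
  by rewrite cfkerEirr inE lin_char1.
(* The values of 'chi_i are powers of zeta; replacing zeta by w carries the
   character over to C. *)
have n_gt0: (0 < #|G|)%N := cardG_gt0 G.
have [zeta prim_zeta] := C_prim_root_exists n_gt0.
have [w prim_w] := closed_prim_root_exists C n_gt0.
have pow_zeta g : {a : 'I_#|G| | 'chi_i g = zeta ^+ a}.
  apply: prim_rootP => //.
  rewrite -lin_charX ?inE // (_ : g ^+ #|G| = 1)%g ?lin_char1 //.
  by apply: expg_cardG; rewrite inE.
pose a g := sval (pow_zeta g).
have zetaE g : zeta ^+ a g = 'chi_i g by rewrite /a; case: (pow_zeta g).
exists [ffun g => w ^+ a g].
  apply: dualP => [|g h]; rewrite !ffunE.
    apply/eqP; rewrite -(expr0 w) (eq_prim_root_expr prim_w).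
    by rewrite -(eq_prim_root_expr prim_zeta) zetaE lin_char1.
  apply/eqP; rewrite -exprD (eq_prim_root_expr prim_w).
  by rewrite -(eq_prim_root_expr prim_zeta) exprD !zetaE lin_charM ?inE.
rewrite ffunE -(expr0 w) (eq_prim_root_expr prim_w).
by rewrite -(eq_prim_root_expr prim_zeta) zetaE.
Qed.

(** The quotient of two characters that agree on H annihilates H. *)
Lemma in_dual_cosetP (gT : finGroupType) (C : fieldType) (H : {group gT})
    (chi psi : {ffun gT -> C}) : chi \in dual -> psi \in dual ->
  in_dual_coset H chi psi <-> {in H, chi =1 psi}.
Proof.
move=> Dchi Dpsi; split=> [[eta /andP[_ /forall_inP eta1] ->] h Hh | eqH].
  by rewrite ffunE (eqP (eta1 h Hh)) mulr1.
exists [ffun g => [ffun g => (chi g)^-1] g * psi g].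
  rewrite inE mul_dual ?inv_dual //=; apply/forall_inP=> h Hh.
  by rewrite !ffunE -eqH // mulVf ?dual_neq0.
by apply/ffunP=> g; rewrite !ffunE mulVKf ?dual_neq0.
Qed.

(** * Orthogonality relations *)

Lemma mulr_fixed_eq0 (C : fieldType) (a s : C) : a != 1 -> s = a * s -> s = 0.
Proof.
move=> neq_a1 /eqP; rewrite -subr_eq0 -{1}[s]mul1r -mulrBl mulf_eq0 subr_eq0.
by rewrite eq_sym (negPf neq_a1) => /eqP.
Qed.

Lemma sum_dual_eq0 (gT : finGroupType) (C : fieldType) (H : {group gT})
    (chi : {ffun gT -> C}) (h : gT) :
  chi \in dual -> h \in H -> chi h != 1 -> \sum_(g in H) chi g = 0.
Proof.
move=> Dchi Hh neq_chih; apply: mulr_fixed_eq0 neq_chih _.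
rewrite mulr_sumr (reindex_inj (mulgI h)) /=.
by apply: eq_big => g; rewrite ?groupMl // dualM.
Qed.

(** Two representatives agreeing on H would both represent the second one. *)
Lemma dual_transversal_inj (gT : finGroupType) (C : fieldType)
    (H : {group gT}) (X : {fset {ffun gT -> C}}) (chi1 chi2 : {ffun gT -> C}) :
    dual_transversal H X -> chi1 \in X -> chi2 \in X ->
  {in H, chi1 =1 chi2} -> chi1 = chi2.
Proof.
move=> [XD _ X_disj] X1 X2 eq12; apply/eqP/negPn/negP=> neq12.
have [D1 D2] := (XD _ X1, XD _ X2).
by apply: (X_disj _ _ X1 X2 neq12 chi2); split; apply/in_dual_cosetP.
Qed.

(** Multiplication by psi sends the coset of chi to that of psi * chi, whose
    representative in X is f chi below; f permutes X, and by the hypothesis on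
    k it multiplies the value at k by psi(k). *)
Lemma sum_dual_transversal_eq0 (gT : finGroupType) (C : fieldType)
    (H : {group gT}) (X : {fset {ffun gT -> C}}) (psi : {ffun gT -> C})
    (k : gT) :
    dual_transversal H X -> psi \in dual -> psi k != 1 ->
    (forall eta : {ffun gT -> C}, eta \in dual_ann H -> eta k = 1) ->
  \sum_(chi <- X) chi k = 0.
Proof.
move=> transX Dpsi neq_psik annk; have [XD X_cover _] := transX.
pose m (chi : {ffun gT -> C}) : {ffun gT -> C} := [ffun g => psi g * chi g].
have Dm chi : chi \in X -> m chi \in dual by move=> /XD; apply: mul_dual.
pose agree chi := [pred xi : {ffun gT -> C} | [forall h in H, xi h == m chi h]].
pose f chi := nth chi X (find (agree chi) X).
have fP chi : chi \in X -> f chi \in X /\ {in H, f chi =1 m chi}.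
  move=> Xchi; have has_f : has (agree chi) X.
    have [xi Xxi /in_dual_cosetP eqH] := (X_cover _).1 (Dm _ Xchi).
    apply/hasP; exists xi => //; apply/forall_inP=> h Hh.
    by rewrite (eqH (XD _ Xxi) (Dm _ Xchi)).
  split=> [|h Hh]; first by rewrite mem_nth // -has_find.
  by have /forall_inP/(_ h Hh)/eqP := nth_find chi has_f.
have f_inj : {in X &, injective f}.
  move=> chi1 chi2 X1 X2 eqf.
  apply: (dual_transversal_inj transX X1 X2) => h Hh.
  apply: (mulfI (dual_neq0 h Dpsi)).
  by have := (fP _ X1).2 h Hh; rewrite eqf (fP _ X2).2 // !ffunE.
have perm_f : perm_eq [seq f chi | chi <- X] X.
  have uX : uniq X by apply: fset_uniq.
  have ufX : uniq [seq f chi | chi <- X] by rewrite map_inj_in_uniq.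
  have sub_f : {subset [seq f chi | chi <- X] <= X}.
    by move=> _ /mapP[chi Xchi ->]; case: (fP chi Xchi).
  apply: uniq_perm => //.
  by have [|_] := uniq_min_size ufX sub_f; rewrite ?size_map.
apply: mulr_fixed_eq0 neq_psik _.
rewrite -{1}(perm_big _ perm_f) big_map mulr_sumr.
apply: eq_big_seq => chi Xchi; have [Xf eqH] := fP _ Xchi.
have [eta /annk eta1 /ffunP/(_ k)] :=
  (in_dual_cosetP H (XD _ Xf) (Dm _ Xchi)).2 eqH.
by rewrite !ffunE eta1 mulr1 => ->.
Qed.

(** A transversal of the characters modulo those trivial on H restricts to the
    full character group of H; this is the column orthogonality of the latter,
    for those k in G at which the value of chi only depends on the coset of
    chi. *)
Lemma sum_dual_transversal (C : numClosedFieldType) (gT : finGroupType)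
    (H : {group gT}) (X : {fset {ffun gT -> C}}) (k : gT) :
    abelian [set: gT] -> dual_transversal H X ->
    (forall eta : {ffun gT -> C}, eta \in dual_ann H -> eta k = 1) ->
  \sum_(chi <- X) chi k = (if k == 1%g then #|H| else 0)%:R.
Proof.
move=> abelG transX; have [XD X_cover _] := transX.
case: eqP => [-> _ | /eqP ntk annk]; last first.
  have [psi Dpsi neq_psik] := dual_separates C abelG ntk.
  exact: sum_dual_transversal_eq0 transX Dpsi neq_psik annk.
have Done : [ffun=> 1] \in @dual gT C.
  by apply: dualP => [|g h]; rewrite !ffunE ?mulr1.
have [chi0 X0 /in_dual_cosetP] := (X_cover _).1 Done.
move=> /(_ (XD _ X0) Done) triv0.
(* The terms with h <> 1 vanish, so summing over all of H changes nothing. *)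
transitivity (\sum_(h in H) \sum_(chi <- X) chi h).
  rewrite [RHS](bigD1 1%g) //= [X in _ + X]big1 ?addr0 // => h /andP[Hh nth].
  have [psi Dpsi neq_psih] := dual_separates C abelG nth.
  apply: sum_dual_transversal_eq0 transX Dpsi neq_psih _ => eta.
  by case/andP=> _ /forall_inP/(_ h Hh)/eqP.
rewrite exchange_big /= (big_fsetD1 chi0) //= [X in _ + X]big1_fset ?addr0.
  by rewrite -sum1_card natr_sum; apply: eq_bigr => h Hh; rewrite triv0 ?ffunE.
move=> chi; rewrite !inE => /andP[neq0 Xchi] _.
have [h Hh chih] : exists2 h, h \in H & chi h != 1.
  apply/exists_inP; rewrite -negb_forall_in.
  apply: contra neq0 => /forall_inP triv; apply/eqP.
  apply: dual_transversal_inj transX Xchi X0 _ => h Hh.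
  by rewrite triv0 // ffunE; apply/eqP/triv.
exact: sum_dual_eq0 (XD _ Xchi) Hh chih.
Qed.

(** * Group determinants of quotients *)

(** The tH with t in T cover G, so the search for an element of T in the coset
    never falls back on its default 1. *)
Lemma transversal_repr_mem (gT : finGroupType) (H : {group gT}) (T : {set gT})
    (c : coset_of H) :
    abelian [set: gT] -> left_transversal H T ->
  transversal_repr 1%g T c \in c.
Proof.
move=> abelG [coverT _]; rewrite /transversal_repr.
case: pickP => [t /setIP[] // | noT] /=.
have : repr c \in [set: gT] by rewrite inE.
rewrite -coverT => /bigcupP[t Tt tH]; have := noT t; rewrite inE Tt /=.
have nH g : g \in 'N(H)%g.
  by apply: (subsetP (sub_abelian_norm abelG (subsetT H))); rewrite inE.
rewrite -{1}(coset_mem (mem_repr_coset c)) val_coset // norm_rlcoset //.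
by rewrite lcoset_sym tH.
Qed.

Lemma rmorph_quotient_det (R S : comNzRingType) (f : {rmorphism R -> S})
    (gT : finGroupType) (H : {group gT}) (T : {set gT}) (y : gT -> R) :
  f (quotient_det H T y) = quotient_det H T (fun t => f (y t)).
Proof.
rewrite /quotient_det /group_det -det_map_mx; congr (\det _).
by apply/matrixP=> i j; rewrite !mxE.
Qed.

Lemma eq_quotient_det (R : comNzRingType) (gT : finGroupType) (H : {group gT})
    (T : {set gT}) (y1 y2 : gT -> R) :
  y1 =1 y2 -> quotient_det H T y1 = quotient_det H T y2.
Proof.
by move=> eqy; congr (\det _); apply/matrixP=> i j; rewrite !mxE.
Qed.

(** The value e(t) at a representative of the coset c d^-1 factors as
    e(c) e(d)^-1, so the two matrices are conjugate by the diagonal matrix of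
    the e(c). *)
Lemma quotient_det_twist (R : comNzRingType) (gT : finGroupType)
    (H : {group gT}) (T : {set gT}) (e y : gT -> R) :
    abelian [set: gT] -> left_transversal H T ->
    {morph e : g h / (g * h)%g >-> g * h} -> {in H, forall h, e h = 1} ->
  quotient_det H T (fun t => e t * y t) = quotient_det H T y.
Proof.
move=> abelG transT eM eH; have e1 : e 1%g = 1 by rewrite eH.
have nH g : g \in 'N(H)%g.
  by apply: (subsetP (sub_abelian_norm abelG (subsetT H))); rewrite inE.
rewrite /quotient_det /group_det; set n := #|_|.
pose r (i : 'I_n) := repr (enum_val i : coset_of H).
pose M := \matrix_(i < n, j < n)
  y (transversal_repr 1%g T (enum_val i * (enum_val j)^-1)%g).
transitivity (\det (diag_mx (\row_i e (r i)) *m M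
                    *m diag_mx (\row_j e (r j)^-1%g))).
  congr (\det _); apply/matrixP=> i j.
  rewrite mul_mx_diag mxE mul_diag_mx !mxE mulrAC -eM; congr (_ * _).
  set t := transversal_repr _ _ _; set s := (r i * _)%g.
  have eq_ts : coset H t = coset H s.
    rewrite (coset_mem (transversal_repr_mem _ abelG transT)).
    by rewrite morphM ?morphV ?groupV //= !coset_reprK.
  have : (t * s^-1)%g \in H.
    by apply: coset_idr => //; rewrite morphM ?morphV ?groupV //= eq_ts mulgV.
  by move/eH=> eq1; rewrite -[RHS]mul1r -eq1 -eM mulgKV.
rewrite !det_mulmx !det_diag mulrAC -big_split /= big1 ?mul1r // => i _.
by rewrite !mxE -eM mulgV.
Qed.

(** * Characters acting on polynomials *)

Definition twist (gT : finGroupType) (C : fieldType) (chi : {ffun gT -> C})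
    (f : {mpoly C[#|gT|]}) : {mpoly C[#|gT|]} :=
  f \mPo [tuple chi (enum_val i) *: 'X_i | i < #|gT|].

Lemma twist_gvar (gT : finGroupType) (C : fieldType) (chi : {ffun gT -> C}) g :
  twist chi (gvar C g) = chi g *: gvar C g.
Proof. by rewrite /twist comp_mpolyXU -tnth_nth tnth_mktuple enum_rankK. Qed.

Lemma mcoeff_twist (gT : finGroupType) (C : fieldType) (chi : {ffun gT -> C})
    (f : {mpoly C[#|gT|]}) (m : 'X_{1..#|gT|}) :
  chi \in dual -> (twist chi f)@_m = chi (mnm_prod m) * f@_m.
Proof.
move=> Dchi; rewrite /twist comp_mpolyEX.
have twistX m' : 'X_[m'] \mPo [tuple chi (enum_val i) *: 'X_i | i < #|gT|]
    = chi (mnm_prod m') *: 'X_[m'] :> {mpoly C[#|gT|]}.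
  rewrite comp_mpolyX /mnm_prod (big_morph _ (dualM Dchi) (dual1 Dchi)).
  rewrite [in RHS](mpolyXE_id C m') -scaler_prod; apply: eq_bigr => i _.
  by rewrite tnth_mktuple exprZn dualX.
rewrite [in RHS](mpolyE f) !(raddf_sum (mcoeff m)) mulr_sumr.
apply: eq_bigr => m' _.
rewrite /= twistX !mcoeffZ mcoeffX; case: eqP => [->|_]; last by rewrite !mulr0.
by rewrite !mulr1 mulrC.
Qed.

Lemma mcoeff_mpart (gT : finGroupType) (R : comNzRingType)
    (f : {mpoly R[#|gT|]}) (h : gT) (m : 'X_{1..#|gT|}) :
  (mpart f h)@_m = if mnm_prod m == h then f@_m else 0.
Proof.
rewrite /mpart raddf_sum /= [in RHS](mpolyE f) raddf_sum /=.
case: ifP => mh.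
  rewrite big_mkcond /=; apply: eq_bigr => m' _; case: ifP => // m'h.
  rewrite mcoeffZ mcoeffX; case: eqP => [eqm|_]; last by rewrite mulr0.
  by rewrite eqm mh in m'h.
rewrite big1 // => m' m'h; rewrite mcoeffZ mcoeffX; case: eqP => [eqm|_].
  by rewrite -eqm m'h in mh.
by rewrite mulr0.
Qed.

(** * The coefficients of z_h *)

Theorem theorem1p2 (R : realType) (gT : finGroupType)
    (abelG : abelian [set: gT]) (H : {group gT}) (T : {set gT})
    (X : {fset {ffun gT -> R[i]}})
    (transT : left_transversal H T) (transX : dual_transversal H X) :
  let ychi (chi : {ffun gT -> R[i]}) (t : gT) : {mpoly R[i][#|gT|]} :=
    \sum_(h' in H) chi (t * h')%g *: gvar R[i] (t * h')%g in
  let z (h : gT) : {mpoly R[i][#|gT|]} :=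
    (#|H|%:R)^-1 *:
      \sum_(chi <- X) chi (h^-1)%g *: quotient_det H T (ychi chi) in
  let y (t : gT) : {mpoly int[#|gT|]} :=
    \sum_(h' in H) gvar int (t * h')%g in
  forall h : gT, h \in H ->
    z h = map_mpoly intr (mpart (quotient_det H T y) h).
Proof.
move=> ychi z y h Hh.
have [XD _ _] := transX.
pose yC t : {mpoly R[i][#|gT|]} := \sum_(h' in H) gvar R[i] (t * h')%g.
pose Theta := quotient_det H T yC.
have ThetaE : map_mpoly intr (quotient_det H T y) = Theta.
  rewrite rmorph_quotient_det; apply: eq_quotient_det => t.
  by rewrite rmorph_sum; apply: eq_bigr => h' _; rewrite /= map_mpolyX.
have twistE chi : twist chi Theta = quotient_det H T (ychi chi).
  rewrite /twist rmorph_quotient_det; apply: eq_quotient_det => t.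
  by rewrite rmorph_sum; apply: eq_bigr => h' _; apply: twist_gvar.
(* Twisting by eta also fixes Theta, so it can only act by 1 on a monomial
   that occurs in Theta. *)
have annE (eta : {ffun gT -> R[i]}) m :
    eta \in dual_ann H -> Theta@_m != 0 -> eta (mnm_prod m) = 1.
  move=> /andP[Deta /forall_inP eta1] nzm; apply: (mulIf nzm).
  rewrite -mcoeff_twist // mul1r; congr (_@_m); rewrite twistE.
  pose e t : {mpoly R[i][#|gT|]} := (eta t)%:MP.
  rewrite /Theta -(quotient_det_twist (e := e) yC abelG transT).
  - apply: eq_quotient_det => t; rewrite mulr_sumr; apply: eq_bigr => h' Hh'.
    by rewrite dualM // (eqP (eta1 _ Hh')) mulr1 mul_mpolyC.
  - by move=> g g'; rewrite /e dualM // mpolyCM.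
  by move=> h' Hh'; rewrite /e (eqP (eta1 _ Hh')).
apply/mpolyP=> m; rewrite mcoeff_map_mpoly mcoeff_mpart /=.
rewrite /z mcoeffZ raddf_sum /=.
have -> : (if mnm_prod m == h then (quotient_det H T y)@_m else 0)%:~R
    = (if mnm_prod m == h then Theta@_m else 0) :> R[i].
  by rewrite -ThetaE mcoeff_map_mpoly; case: ifP.
pose S := \sum_(chi <- X) chi (h^-1 * mnm_prod m)%g.
transitivity (#|H|%:R^-1 * S * Theta@_m).
  rewrite -mulrA mulr_suml; congr (_ * _); apply: eq_big_seq => chi /XD Dchi.
  by rewrite mcoeffZ -twistE mcoeff_twist // dualM // mulrA.
have [->|nzm] := eqVneq (Theta@_m) 0; first by rewrite mulr0 if_same.
rewrite /S (sum_dual_transversal abelG transX) => [|eta ann_eta]; last first.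
  have /andP[Deta /forall_inP eta1] := ann_eta.
  by rewrite dualM // (annE _ _ ann_eta nzm) mulr1 (eqP (eta1 _ _)) ?groupV.
rewrite -(inj_eq (mulgI h)) mulKVg mulg1; case: ifP => _; last first.
  by rewrite mulr0 mul0r.
by rewrite mulVf ?mul1r // pnatr_eq0 -lt0n cardG_gt0.
Qed.
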